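(* For all real $\varepsilon > 0$, there exists a constant $C = C(\varepsilon) > 0$ such that, for all integers $m > n \geq 1$, \[ C^{-1} \left|\frac{1}{n} - \frac{1}{m}\right|^{1+\varepsilon} \leq \left|\frac{1}{p_n} - \frac{1}{p_m}\right| \leq C \left|\frac{1}{n} - \frac{1}{m}\right|^{0.475}. \]
   Context: $p_n$ denotes the $n$th prime number, indexed by positive integers $n \geq 1$ in increasing order ($p_1 = 2$, $p_2 = 3$, ...). *)

(* Defs.v *)
From HB Require Import structures.
From mathcomp Require Import all_boot all_order all_algebra.
From mathcomp Require Import all_classical all_reals exp.
Set Implicit Arguments. Unset Strict Implicit. Unset Printing Implicit Defensive.

Lemma exists_prime_gt (k : nat) : exists p, (k < p) && prime p.
Proof. by have [p ltkp pr_p] := prime_above k; exists p; rewrite ltkp. Qed.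

Definition next_prime (k : nat) : nat := ex_minn (exists_prime_gt k).

(* Indexed from 1: nth_prime 1 = 2, nth_prime 2 = 3, nth_prime 3 = 5.
   The value nth_prime 0 = 0 is junk. *)
Definition nth_prime (n : nat) : nat := iter n next_prime 0.

Lemma prime_nth_prime (n : nat) : 0 < n -> prime (nth_prime n).
Proof.
by case: n => // n _; rewrite /nth_prime iterS /next_prime; case: ex_minnP => p /andP[].
Qed.

Lemma nth_prime_ltS (n : nat) : nth_prime n < nth_prime n.+1.
Proof. by rewrite /nth_prime iterS /next_prime; case: ex_minnP => p /andP[]. Qed.

Lemma nth_prime_surj (p : nat) : prime p -> exists2 n, 0 < n & nth_prime n = p.
Proof.
move=> pr_p.
have lt_id n : n <= nth_prime n.
  by elim: n => // n IHn; apply: leq_ltn_trans IHn (nth_prime_ltS n).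
have ex_n : exists n, p <= nth_prime n by exists p.
case: (ex_minnP ex_n) => -[|n] le_pn min_n.
  by have := prime_gt0 pr_p; rewrite ltnNge le_pn.
exists n.+1 => //; apply/eqP; rewrite eqn_leq le_pn andbT.
have lt_np : nth_prime n < p by rewrite ltnNge; apply/negP => /min_n; rewrite ltnn.
rewrite /nth_prime iterS /next_prime; case: ex_minnP => q _; apply.
by rewrite lt_np.
Qed.

(* Main.v *)
(* Upper bound: p_n >= n makes the middle term at most 1/n, while
   1/n - 1/m >= 1/n - 1/(n+1) >= 1/(2n^2); this gives the exponent 1/2, so
   nothing about prime gaps is needed.
   Lower bound: Chebyshev's estimate, read off the prime factorization of the
   central binomial coefficient, gives p_n <= K n^(1+d) with d = eps/2. For
   l = min(m, 2n) the middle term is at least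
   1/p_n - 1/p_l >= (l - n)/(p_n p_l), and (l - n)/(n l) >= (1/n - 1/m)/2. *)
Require Import Defs.
From mathcomp Require Import all_boot all_order all_algebra.
From mathcomp Require Import all_classical all_reals exp.
From mathcomp Require Import zify ring lra.
Set Implicit Arguments. Unset Strict Implicit. Unset Printing Implicit Defensive.
Import Order.TTheory GRing.Theory Num.Theory.

(** Legendre's formula, whose terms vanish once [p ^ k] exceeds [n]. A cut-off [t] independent of
    [n] lets the sums for several factorials be compared term by term. *)
Lemma logn_fact_trunc (p n t : nat) : prime p -> n < p ^ t.+1 ->
  logn p n`! = \sum_(1 <= k < t.+1) n %/ p ^ k.
Proof.
move=> pr_p lt_n; rewrite logn_fact //.
have trunc s N : n < p ^ s.+1 -> s <= N ->
    \sum_(1 <= k < N.+1) n %/ p ^ k = \sum_(1 <= k < s.+1) n %/ p ^ k.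
  move=> lt_ns le_sN; rewrite (@big_cat_nat _ _ _ s.+1) //=.
  rewrite [X in _ + X](_ : _ = 0) ?addn0 // big_nat big1 // => i /andP[lt_si _].
  by apply/divn_small/(leq_trans lt_ns); rewrite leq_pexp2l ?prime_gt0.
have [/trunc->//|/ltnW le_nt] := leqP t n.
symmetry; apply: trunc le_nt.
by apply: ltn_trans (ltn_expl n (prime_gt1 pr_p)) _; rewrite ltn_exp2l ?prime_gt1.
Qed.

(** By Legendre's formula the exponent is a sum of [t] terms, with [t] the integer part of the
    base-[p] logarithm of [n]. Each term is 0 or 1, since adding [k] and [n - k] carries at most one
    into the quotient by [p ^ j]. *)
Lemma expn_logn_bin (p n k : nat) : prime p -> k <= n -> 0 < n ->
  p ^ logn p 'C(n, k) <= n.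
Proof.
move=> pr_p le_kn n_gt0; have p_gt1 := prime_gt1 pr_p.
apply: leq_trans (trunc_logP p_gt1 n_gt0); rewrite leq_exp2l //.
set t := trunc_log p n.
have lt_n := trunc_log_ltn n p_gt1; rewrite -/t in lt_n.
have fact_eq i : i <= n -> logn p i`! = \sum_(1 <= j < t.+1) i %/ p ^ j.
  by move=> le_in; apply: logn_fact_trunc (leq_ltn_trans le_in lt_n).
have := congr1 (logn p) (bin_fact le_kn).
rewrite !lognM ?muln_gt0 ?fact_gt0 ?bin_gt0 // !fact_eq ?leq_subr // -big_split /=.
have : \sum_(1 <= j < t.+1) n %/ p ^ j
    <= \sum_(1 <= j < t.+1) (k %/ p ^ j + (n - k) %/ p ^ j + 1).
  by apply: leq_sum => j _; rewrite -{1}(subnKC le_kn) leq_divDl.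
rewrite big_split /= sum_nat_const_nat; lia.
Qed.

Lemma bin_le_expn_primes (n k : nat) : k <= n -> 0 < n ->
  'C(n, k) <= n ^ size (primes 'C(n, k)).
Proof.
move=> le_kn n_gt0.
rewrite {1}(@prod_prime_decomp 'C(n, k)) ?bin_gt0 // prime_decompE big_map /=.
rewrite -sum1_size expn_sum big_seq [leqRHS]big_seq; apply: leq_prod => p.
by rewrite mem_primes expn1 => /andP[pr_p _]; apply: expn_logn_bin.
Qed.

Lemma expn2_le_central_bin (n : nat) : 2 ^ n <= 'C(n.*2, n).
Proof.
elim: n => // n IHn; rewrite doubleS binS expnS mul2n -addnn.
(* Both Pascal summands equal 'C(2n+1, n) by symmetry, hence are at least 'C(2n, n). *)
apply: leq_add; apply: leq_trans IHn _; last by rewrite leq_bin2l.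
by rewrite -(@bin_sub _ n.+1) ?subSS -?addnn ?addnK ?leq_bin2l //; lia.
Qed.

Lemma leq_nth_prime : {mono nth_prime : m n / m <= n}.
Proof. exact/leq_mono/(homo_ltn ltn_trans nth_prime_ltS). Qed.

Lemma leq_id_nth_prime (n : nat) : n <= nth_prime n.
Proof. by elim: n => // n /leq_ltn_trans; apply; apply: nth_prime_ltS. Qed.

Lemma leq_sub_nth_prime (m n : nat) : m <= n ->
  n - m <= nth_prime n - nth_prime m.
Proof.
elim: n => [|n IHn] //; rewrite leq_eqVlt => /predU1P[->|]; first by rewrite subnn.
rewrite ltnS => le_mn; have := IHn le_mn; have := nth_prime_ltS n.
have := le_mn; rewrite -leq_nth_prime; lia.
Qed.

(** Since [nth_prime] enumerates all primes, the prime divisors lie among its values at 1, ...,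
    n. *)
Lemma size_primes_le (n b : nat) : (forall q, q \in primes b -> q <= nth_prime n) ->
  size (primes b) <= n.
Proof.
move=> le_n; rewrite -[n in leqRHS](size_iota 1) -(size_map nth_prime (iota 1 n)).
apply: uniq_leq_size (primes_uniq b) _ => q q_b; have := le_n q q_b.
move: q_b; rewrite mem_primes => /andP[/nth_prime_surj[i i_gt0 <-] _].
by rewrite leq_nth_prime => le_in; apply: map_f; rewrite mem_iota i_gt0 add1n ltnS.
Qed.

(* 'C(2h, h) >= 2^h has at most n prime factors when 2h <= p_n, and each of its
   primary parts is at most 2h. *)
Lemma expn2_half_nth_prime_le (n : nat) : 0 < n ->
  2 ^ (nth_prime n)./2 <= nth_prime n ^ n.
Proof.
move=> n_gt0; set p := nth_prime n; have p_gt1 := prime_gt1 (prime_nth_prime n_gt0).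
set h := p./2; have le_hp : h.*2 <= p by rewrite /h; lia.
have h_gt0 : 0 < h by rewrite half_gt0.
apply: leq_trans (expn2_le_central_bin h) _.
have le_h : h <= h.*2 by rewrite -addnn leq_addr.
apply: leq_trans (bin_le_expn_primes le_h _) _; first by rewrite double_gt0.
apply: (@leq_trans (h.*2 ^ n)); last by rewrite leq_exp2r.
rewrite leq_pexp2l ?double_gt0 //; apply: size_primes_le => q q_b.
apply: leq_trans le_hp.
have pr_q : prime q by move: q_b; rewrite mem_primes => /andP[].
apply: leq_trans (expn_logn_bin pr_q le_h _); last by rewrite double_gt0.
by rewrite -{1}[q]expn1 leq_exp2l ?prime_gt1 // logn_gt0.
Qed.

Local Open Scope ring_scope.

(** Apply ln y <= y - 1 to y = x^a. *)
Lemma ln_le_powR (R : realType) (x a : R) : 0 < x -> 0 < a ->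
  ln x <= x `^ a / a.
Proof.
move=> x_gt0 a_gt0; rewrite ler_pdivlMr // mulrC -ln_powR.
have xa_gt0 : 0 < x `^ a by rewrite powR_gt0.
have /le_ln1Dx : -1 < x `^ a - 1 by lra.
rewrite addrC subrK; lra.
Qed.

Lemma powR_mul (R : realType) (x a b : R) : 0 < x -> x `^ (a + b) = x `^ a * x `^ b.
Proof. by move=> x_gt0; rewrite powRD // (gt_eqF x_gt0) implybT. Qed.

Lemma nth_prime_le (R : realType) (d : R) : 0 < d ->
  exists2 K : R, 0 < K &
    forall n : nat, (0 < n)%N -> (nth_prime n)%:R <= K * n%:R `^ (1 + d).
Proof.
move=> d_gt0; have d1_gt0 : 0 < 1 + d by lra.
(* This choice of [a] makes (1 - a) * (1 + d) = 1. *)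
pose a := d / (1 + d); have a_gt0 : 0 < a by rewrite divr_gt0.
have ln2_gt0 : 0 < ln 2 :> R by rewrite ln_gt0 ?ltr1n.
have aln2_gt0 : 0 < a * ln 2 := mulr_gt0 a_gt0 ln2_gt0.
pose K := 3 / (a * ln 2); have K_gt0 : 0 < K by rewrite divr_gt0.
exists (K `^ (1 + d)) => [|n n_gt0]; first by rewrite powR_gt0.
set p := nth_prime n; have p_gt1 : (1 < p)%N := prime_gt1 (prime_nth_prime n_gt0).
have p_gt0 : 0 < p%:R :> R by rewrite ltr0n ltnW.
have cheb : p%:R * ln 2 <= 3 * n%:R * ln p%:R :> R.
  have : (2 ^ p./2)%:R <= (p ^ n)%:R :> R by rewrite ler_nat expn2_half_nth_prime_le.
  rewrite !natrX -ler_ln ?posrE ?exprn_gt0 // !lnXn // -!(mulr_natl (ln _)).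
  (* The factor 3 absorbs the rounding in [p./2]; equality occurs at p = 3. *)
  have : p%:R <= 3 * (p./2)%:R :> R by rewrite -natrM ler_nat; lia.
  nra.
(* Bound ln p by p^a / a in [cheb] and cancel p^a. *)
have le_p : p%:R `^ (1 - a) <= K * n%:R.
  have : p%:R `^ (1 - a) * p%:R `^ a = p%:R :> R.
    by rewrite -powR_mul // subrK powRr1 // ltW.
  have := ln_le_powR p_gt0 a_gt0; set u := p%:R `^ a; set v := p%:R `^ (1 - a).
  have u_gt0 : 0 < u by rewrite powR_gt0.
  rewrite ler_pdivlMr // => le_ln v_u.
  rewrite /K mulrAC ler_pdivlMr // -(ler_pM2r u_gt0).
  have -> : v * (a * ln 2) * u = p%:R * ln 2 * a by rewrite -v_u; ring.
  apply: le_trans (ler_wpM2r (ltW a_gt0) cheb) _.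
  by rewrite -(mulrA (3 * n%:R)) ler_wpM2l ?mulr_ge0.
rewrite -powRM ?(ltW K_gt0) //.
have -> : p%:R = (p%:R `^ (1 - a)) `^ (1 + d) :> R.
  by rewrite -powRrM mulrBl divfK ?gt_eqF // mul1r addrK powRr1 ?ltW.
apply: ge0_ler_powR le_p; rewrite ?nnegrE ?powR_ge0 ?(ltW d1_gt0) //.
by rewrite mulr_ge0 // ltW.
Qed.

Lemma inv_nth_prime_sub_le (R : realType) (n m : nat) :
  (0 < n)%N -> (n < m)%N ->
  1 / (nth_prime n)%:R - 1 / (nth_prime m)%:R
    <= 2 * (1 / n%:R - 1 / m%:R) `^ (475 / 1000) :> R.
Proof.
move=> n_gt0 lt_nm; have n0 : 0 < n%:R :> R by rewrite ltr0n.
have m0 : 0 < m%:R :> R by rewrite ltr0n (leq_trans _ lt_nm).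
have le1n : 1 <= n%:R :> R by rewrite ler1n.
have leSm : n%:R + 1 <= m%:R :> R by rewrite natr1 ler_nat.
have le_np : n%:R <= (nth_prime n)%:R :> R by rewrite ler_nat leq_id_nth_prime.
set D := (1 / n%:R - 1 / m%:R); set e := 475 / 1000.
have le_D : n%:R^-1 ^+ 2 <= 2 * D.
  (* The first two summands give the value at m = n + 1; the last is the gain from a larger m. *)
  have -> : 2 * D = n%:R^-1 ^+ 2 + (n%:R - 1) / (n%:R ^+ 2 * (n%:R + 1))
        + 2 * ((n%:R + 1)^-1 - m%:R^-1).
    by rewrite /D; field; rewrite !gt_eqF ?ltr_wpDl.
  have : 0 <= (n%:R - 1) / (n%:R ^+ 2 * (n%:R + 1)) :> R.
    by rewrite divr_ge0 ?subr_ge0 // mulr_ge0 ?exprn_ge0 ?addr_ge0 // ltW.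
  have : m%:R^-1 <= (n%:R + 1)^-1 :> R by rewrite lef_pV2 ?posrE // ltr_wpDl ?ltW.
  lra.
apply: (@le_trans _ _ n%:R^-1).
  rewrite !mul1r lerBlDr ler_wpDr ?invr_ge0 // lef_pV2 ?posrE //; lra.
have vn_01 : 0 < (n%:R^-1 : R) <= 1 by rewrite invr_gt0 n0 invf_le1.
have D_ge0 : 0 <= D by have := exprn_ge0 2 (ltW (andP vn_01).1); lra.
have e_ge0 : 0 <= e by rewrite /e; lra.
(* As 2e = 0.95 <= 1 and 1/n <= 1, 1/n <= (1/n^2)^e. *)
have := ger1_powR vn_01 (_ : 2%:R * e <= 1).
rewrite powRrM powR_mulrn ?invr_ge0 ?(ltW n0) // => /(_ _)/le_trans; apply.
  by rewrite /e; lra.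
apply: le_trans (ge0_ler_powR e_ge0 _ _ le_D) _.
- by rewrite nnegrE exprn_ge0 ?invr_ge0 ?ltW.
- by rewrite nnegrE mulr_ge0.
rewrite powRM // ler_wpM2r ?powR_ge0 // ler1_powR //; rewrite /e; lra.
Qed.

Theorem corollary1p2 (R : realType) (eps : R) (eps_gt0 : 0 < eps) :
  exists2 C : R, 0 < C &
    forall n m : nat, (1 <= n)%N -> (n < m)%N ->
      C^-1 * `|1 / n%:R - 1 / m%:R| `^ (1 + eps)
        <= `|1 / (nth_prime n)%:R - 1 / (nth_prime m)%:R|
        <= C * `|1 / n%:R - 1 / m%:R| `^ (475 / 1000).
Proof.
(* Two primes of index at most 2n cost a factor of order n^(2d) = n^eps, which D^eps <= n^(-eps)
   compensates. *)
pose d := eps / 2; have d_gt0 : 0 < d by rewrite divr_gt0.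
have [K K_gt0 le_K] := nth_prime_le d_gt0.
(* [K ^+ 2] comes from bounding two primes, 2 from [le_D], and the power of 2 from l <= 2n. *)
pose B := K ^+ 2 * 2 * 2 `^ d; have B_gt0 : 0 < B by rewrite !mulr_gt0 ?exprn_gt0 ?powR_gt0.
exists (B + 2) => [|n m n_gt0 lt_nm]; first by rewrite addr_gt0.
have n0 : 0 < n%:R :> R by rewrite ltr0n.
have m0 : 0 < m%:R :> R by rewrite ltr0n (leq_trans _ lt_nm).
have D_gt0 : 0 < 1 / n%:R - 1 / m%:R :> R.
  by rewrite subr_gt0 !mul1r ltf_pV2 ?posrE // ltr_nat.
have pr_gt0 k : (0 < k)%N -> 0 < (nth_prime k)%:R :> R.
  by move=> k_gt0; rewrite ltr0n prime_gt0 ?prime_nth_prime.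
have p0 := pr_gt0 n n_gt0; have q0 := pr_gt0 m (ltn_trans n_gt0 lt_nm).
have pD_ge0 : 0 <= 1 / (nth_prime n)%:R - 1 / (nth_prime m)%:R :> R.
  by rewrite subr_ge0 !mul1r lef_pV2 ?posrE // ler_nat leq_nth_prime ltnW.
rewrite (gtr0_norm D_gt0) (ger0_norm pD_ge0); apply/andP; split; last first.
  apply: le_trans (inv_nth_prime_sub_le R n_gt0 lt_nm) _.
  by rewrite ler_wpM2r ?powR_ge0 // lerDr ltW.
rewrite powR_mul // powRr1 ?(ltW D_gt0) //; set D := 1 / n%:R - 1 / m%:R.
have e0 := ltW eps_gt0.
have ne_gt0 : 0 < n%:R `^ eps :> R by rewrite powR_gt0.
(* This is D <= 1/n raised to the power [eps]. *)
have le_Dd : D `^ eps <= (n%:R `^ eps)^-1.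
  rewrite -[leRHS]div1r ler_pdivlMr // -powRM ?(ltW D_gt0) //.
  apply: (@le_trans _ _ (1 `^ eps)); last by rewrite powR1.
  apply: ge0_ler_powR; rewrite ?nnegrE ?ler01 ?mulr_ge0 ?(ltW D_gt0) //.
  by rewrite /D mulrBl divfK ?gt_eqF // lerBlDr lerDl mulr_ge0 ?divr_ge0 ?ltW.
pose l := minn m n.*2.
have lt_nl : (n < l)%N by rewrite /l; lia.
have l_gt0 := ltn_trans n_gt0 lt_nl.
have l0 : 0 < l%:R :> R by rewrite ltr0n.
have s0 := pr_gt0 l l_gt0.
(* If m <= 2n, the quotient is D itself; otherwise l = 2n and the right side is 1/n. *)
have le_D : D <= 2 * ((l%:R - n%:R) / (n%:R * l%:R)).
  have [le_m2n|lt_2nm] := leqP m n.*2.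
    have -> : l = m by apply/minn_idPl.
    have <- : D = (m%:R - n%:R) / (n%:R * m%:R) by rewrite /D; field; rewrite !gt_eqF.
    have := ltW D_gt0; rewrite -/D; lra.
  have -> : l = n.*2 by apply/minn_idPr/ltnW.
  rewrite -muln2 natrM.
  have -> : 2 * ((n%:R * 2 - n%:R) / (n%:R * (n%:R * 2))) = 1 / n%:R :> R.
    by field; rewrite gt_eqF.
  by rewrite /D lerBlDr lerDl divr_ge0 // ltW.
(* Replacing m by l <= m shrinks the difference, and consecutive primes differ by at least 1. *)
have le_f : (l%:R - n%:R) / ((nth_prime n)%:R * (nth_prime l)%:R)
    <= 1 / (nth_prime n)%:R - 1 / (nth_prime m)%:R :> R.
  apply: (@le_trans _ _ (1 / (nth_prime n)%:R - 1 / (nth_prime l)%:R)).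
    have -> : 1 / (nth_prime n)%:R - 1 / (nth_prime l)%:R
        = ((nth_prime l)%:R - (nth_prime n)%:R)
          / ((nth_prime n)%:R * (nth_prime l)%:R) :> R.
      by field; rewrite !gt_eqF.
    rewrite ler_pM2r ?invr_gt0 ?mulr_gt0 //.
    have le_nl := ltnW lt_nl.
    by rewrite -!natrB ?leq_nth_prime // ler_nat leq_sub_nth_prime.
  by rewrite lerD2l lerN2 !mul1r lef_pV2 ?posrE // ler_nat leq_nth_prime geq_minl.
have le_pq : (nth_prime n)%:R * (nth_prime l)%:R
    <= K ^+ 2 * (n%:R * l%:R) * (2 `^ d * n%:R `^ eps) :> R.
  have le_ld : l%:R `^ d <= 2 `^ d * n%:R `^ d :> R.
    have le_l2n : l%:R <= 2 * n%:R :> R by rewrite -natrM ler_nat mul2n geq_minr.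
    rewrite -powRM //; apply: ge0_ler_powR; rewrite ?nnegrE ?(ltW d_gt0) //.
    exact: mulr_ge0.
  apply: le_trans (ler_pM (ler0n R _) (ler0n R _) (le_K _ n_gt0) (le_K _ l_gt0)) _.
  have -> : eps = d + d by rewrite /d; field.
  rewrite !powR_mul // !powRr1 ?(ltW l0) //.
  have c_ge0 : 0 <= K ^+ 2 * (n%:R * l%:R) * n%:R `^ d :> R.
    by rewrite !mulr_ge0 ?exprn_ge0 ?powR_ge0 ?(ltW K_gt0).
  have := ler_wpM2l c_ge0 le_ld; lra.
rewrite ler_pdivrMl ?addr_gt0 //.
set N := l%:R - n%:R in le_D le_f; have N_ge0 : 0 <= N.
  by rewrite subr_ge0 ler_nat ltnW.
apply: (@le_trans _ _ (B * (N / ((nth_prime n)%:R * (nth_prime l)%:R)))); last first.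
  by rewrite ler_pM // ?(ltW B_gt0) ?divr_ge0 ?mulr_ge0 // lerDl.
apply: le_trans (ler_pM (ltW D_gt0) (powR_ge0 _ _) le_D le_Dd) _.
have d2_gt0 : 0 < 2 `^ d :> R by rewrite powR_gt0.
have pq_gt0 := mulr_gt0 p0 s0.
rewrite [leRHS]mulrA ler_pdivlMr //.
apply: le_trans (ler_wpM2l _ le_pq) _.
  by rewrite mulr_ge0 ?invr_ge0 ?(ltW ne_gt0) // mulr_ge0 // divr_ge0 // mulr_ge0.
(* With the bound on the product of primes inserted, the two sides are equal by the choice of
   [B]. *)
rewrite /B le_eqVlt; apply/orP; left; apply/eqP; field.
by rewrite !gt_eqF.
Qed.
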